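(* Let $m,n,r,d$ be integers with $m,n\ge2$, $d\ge1$, $0<r<\min\{m,n\}$, let $0\le a\le rd$, and set $\alpha=\lfloor a/(n-r)\rfloor$, $s=a\bmod(n-r)$, $\beta=\lfloor(rd-a)/(m-r)\rfloor$, $t=(rd-a)\bmod(m-r)$. Let $\mathcal{O}_a$ be the set of all $P\in\mathbb{C}[\lambda]^{m\times n}_d$ of normal rank $r$ whose $r$ invariant polynomials are all equal to $1$, whose partial multiplicity sequence at $\infty$ (with respect to $d$) consists only of zeros, whose left nullspace $\mathcal{N}_\ell(P)$ has minimal indices $\beta+1$ ($t$ times) and $\beta$ ($m-r-t$ times), and whose right nullspace $\mathcal{N}_r(P)$ has minimal indices $\alpha+1$ ($s$ times) and $\alpha$ ($n-r-s$ times). Then $\mathcal{O}_a$ equals the set of all products $L(\lambda)R(\lambda)$ with $L\in\mathbb{C}[\lambda]^{m\times r}$, $R\in\mathbb{C}[\lambda]^{r\times n}$ such that: the columns of $L$ form a minimal basis and the rows of $R$ form a minimal basis; $\mathcal{N}_\ell(L)$ has minimal indices $\beta+1$ ($t$ times) and $\beta$ ($m-r-t$ times); $\mathcal{N}_r(R)$ has minimal indices $\alpha+1$ ($s$ times) and $\alpha$ ($n-r-s$ times); and $\deg(L_{*i})+\deg(R_{i*})=d$ for $i=1,\dots,r$.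
   Context: $\mathbb{C}[\lambda]^{m\times n}_d$: complex $m\times n$ polynomial matrices of degree at most $d$; degree = maximum degree of entries, $\deg0=-\infty$; $L_{*i}$ is the $i$th column, $R_{i*}$ the $i$th row. Normal rank: rank over $\mathbb{C}(\lambda)$. A minimal basis of a subspace of $\mathbb{C}(\lambda)^k$ is a polynomial basis with minimal sum of degrees; the minimal indices of the subspace are the degrees of the vectors of any minimal basis. $\mathcal{N}_\ell(X)=\{y:yX=0\}$, $\mathcal{N}_r(X)=\{x:Xx=0\}$ over $\mathbb{C}(\lambda)$. Invariant polynomials are the nonzero diagonal entries $e_1|\cdots|e_r$ of the Smith form. The partial multiplicity sequence at $\alpha_0\in\mathbb{C}$ is the list of exponents of $(\lambda-\alpha_0)$ in $e_1,\dots,e_r$; the partial multiplicity sequence at $\infty$ with respect to $d$ is that of $\lambda^dP(1/\lambda)$ at $0$. *)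

(* Defs.v *)
From HB Require Import structures.
From mathcomp Require Import all_boot all_order all_algebra.
From mathcomp Require Export reals complex fraction.
Set Implicit Arguments. Unset Strict Implicit. Unset Printing Implicit Defensive.
Import Order.TTheory GRing.Theory Num.Theory.
Local Open Scope ring_scope.

Section PolyMx.
Variable F : fieldType.
Local Notation PF := {poly F}.
Local Notation QF := {fraction {poly F}}.

Definition fracmx m n (A : 'M[PF]_(m, n)) : 'M[QF]_(m, n) := map_mx (@tofrac _) A.

Definition normal_rank m n (A : 'M[PF]_(m, n)) : nat := \rank (fracmx A).

Definition polydeg_le (d : nat) m n (A : 'M[PF]_(m, n)) : Prop :=
  forall i j, (size (A i j) <= d.+1)%N.

(* degree of a polynomial (row) vector = max degree of its entries
   (the zero vector gets 0 here; it never occurs in a basis) *)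
Definition rvdeg k (v : 'rV[PF]_k) : nat := \max_(j < k) (size (v ord0 j)).-1.

Definition rowdegs p k (B : 'M[PF]_(p, k)) : seq nat :=
  [seq rvdeg (row i B) | i <- enum 'I_p].

Definition is_poly_basis q p k (V : 'M[QF]_(q, k)) (B : 'M[PF]_(p, k)) : bool :=
  row_free (fracmx B) && (fracmx B == V)%MS.

Definition is_minimal_basis q p k (V : 'M[QF]_(q, k)) (B : 'M[PF]_(p, k)) : Prop :=
  is_poly_basis V B /\
  forall p' (B' : 'M[PF]_(p', k)), is_poly_basis V B' ->
    (sumn (rowdegs B) <= sumn (rowdegs B'))%N.

Definition has_minimal_indices q k (V : 'M[QF]_(q, k)) (idx : seq nat) : Prop :=
  exists B : 'M[PF]_(size idx, k), is_minimal_basis V B /\ perm_eq (rowdegs B) idx.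

Definition left_null m n (A : 'M[PF]_(m, n)) : 'M[QF]_m := kermx (fracmx A).
(* right nullspace {x : A x = 0} over F(lambda); its vectors x are stored as rows x^T *)
Definition right_null m n (A : 'M[PF]_(m, n)) : 'M[QF]_n := kermx (fracmx A)^T.

Definition diag_seq m n (e : seq PF) : 'M[PF]_(m, n) :=
  \matrix_(i < m, j < n) (if (i : nat) == j then e`_i else 0).

Definition invariant_polys m n (A : 'M[PF]_(m, n)) (e : seq PF) : Prop :=
  [/\ size e = normal_rank A,
      all (fun q => q \is monic) e,
      (forall i, (i.+1 < size e)%N -> e`_i %| e`_i.+1) &
      exists (U : 'M[PF]_m) (V : 'M[PF]_n),
        [/\ U \in unitmx, V \in unitmx & U *m A *m V = diag_seq m n e]].

Definition pmult_seq (x : F) (e : seq PF) : seq nat := [seq mup x q | q <- e].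

(* d-reversal lambda^d A(1/lambda) *)
Definition revd (d : nat) m n (A : 'M[PF]_(m, n)) : 'M[PF]_(m, n) :=
  map_mx (fun p : PF => \poly_(i < d.+1) p`_(d - i)) A.

Definition pm_infty_zero (d : nat) m n (A : 'M[PF]_(m, n)) : Prop :=
  exists e, invariant_polys (revd d A) e /\ all (pred1 0%N) (pmult_seq 0 e).

End PolyMx.

Definition O_a (Rl : realType) (m n r d : nat) (lidx ridx : seq nat)
  (P : 'M[{poly Rl[i]}]_(m, n)) : Prop :=
  [/\ polydeg_le d P, normal_rank P = r, invariant_polys P (nseq r 1),
      pm_infty_zero d P &
      has_minimal_indices (left_null P) lidx /\
      has_minimal_indices (right_null P) ridx].

(* Main.v *)
(** If all invariant polynomials of [P] are [1], then its Smith form writes [P] as a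
product of a left invertible and a right invertible matrix. Choosing the rows of the
right factor [R] to be a minimal basis, with degrees [rho_k], the predictable degree
property bounds the degree of the [k]-th column of the left factor [L] by [d - rho_k].
Hence the [d]-reversal of [P] factors through reversals of [L] and [R]; at [0] it is
the product of the matrices of top coefficients. The absence of infinite elementary
divisors says that this product has rank [r], so the columns of [L] have degree
exactly [d - rho_k], and [L] is column reduced and left invertible, that is, its
columns form a minimal basis.

Conversely, an exchange argument shows that a minimal basis is row reduced and, over
an algebraically closed field, of full rank at every point. So [L R] has rank [r] at
every point, and its [d]-reversal has rank [r] at [0]. *)

Require Import Defs.
From mathcomp Require Import all_boot all_order all_algebra all_fingroup.
From mathcomp Require Import reals complex fraction boolp.
Set Implicit Arguments.
Unset Strict Implicit.
Unset Printing Implicit Defensive.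
Import Order.TTheory GRing.Theory Num.Theory.
Local Open Scope ring_scope.

(** * Smith form *)

Section Equivalence.
Variable R : comUnitRingType.

Definition mx_equiv m n (A B : 'M[R]_(m, n)) : Prop :=
  exists (U : 'M[R]_m) (V : 'M[R]_n),
    [/\ U \in unitmx, V \in unitmx & U *m A *m V = B].

Lemma mx_equiv_refl m n (A : 'M[R]_(m, n)) : mx_equiv A A.
Proof. by exists 1%:M, 1%:M; rewrite !unitmx1 mul1mx mulmx1. Qed.

Lemma mx_equiv_trans m n (B A C : 'M[R]_(m, n)) :
  mx_equiv A B -> mx_equiv B C -> mx_equiv A C.
Proof.
move=> [U [V [uU uV <-]]] [U' [V' [uU' uV' <-]]].
exists (U' *m U), (V *m V'); split; rewrite ?unitmx_mul ?uU ?uV ?uU' ?uV' //.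
by rewrite !mulmxA.
Qed.

Lemma mx_equiv_mull m n (U : 'M[R]_m) (A : 'M_(m, n)) :
  U \in unitmx -> mx_equiv A (U *m A).
Proof. by move=> uU; exists U, 1%:M; rewrite unitmx1 mulmx1. Qed.

Lemma mx_equiv_mulr m n (V : 'M[R]_n) (A : 'M_(m, n)) :
  V \in unitmx -> mx_equiv A (A *m V).
Proof. by move=> uV; exists 1%:M, V; rewrite unitmx1 mul1mx. Qed.

Lemma mx_equivZ m n (a : R) (A B : 'M_(m, n)) :
  mx_equiv A B -> mx_equiv (a *: A) (a *: B).
Proof.
move=> [U [V [uU uV <-]]]; exists U, V; split=> //.
by rewrite -scalemxAr -scalemxAl.
Qed.

Lemma transvection_unit n (i k : 'I_n) (c : R) :
  i != k -> 1%:M + c *: delta_mx i k \in unitmx.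
Proof.
move=> ik.
have E2 : delta_mx i k *m delta_mx i k = 0 :> 'M[R]_n.
  by rewrite mul_delta_mx_0 // eq_sym.
have: (1%:M + c *: delta_mx i k) *m (1%:M - c *: delta_mx i k) = 1%:M.
  rewrite mulmxBr mulmx1 mulmxDl mul1mx -scalemxAl -scalemxAr E2 !scaler0 addr0.
  by rewrite addrK.
by case/mulmx1_unit.
Qed.

Lemma mx_equiv_addrow m n (i k : 'I_m) (c : R) (A : 'M_(m, n)) : i != k ->
  mx_equiv A (\matrix_(x, y) (A x y + (if x == i then c * A k y else 0))).
Proof.
move=> ik; have := mx_equiv_mull A (@transvection_unit _ i k c ik).
congr mx_equiv; apply/matrixP=> x y; rewrite mulmxDl mul1mx -scalemxAl !mxE.
congr (_ + _); rewrite (bigD1 k) //= !mxE eqxx andbT big1 ?addr0; last first.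
  by move=> l lk; rewrite !mxE (negPf lk) andbF mul0r.
by case: eqP; rewrite ?mul1r ?mul0r ?mulr0.
Qed.

Lemma mx_equiv_addcol m n (j l : 'I_n) (c : R) (A : 'M_(m, n)) : l != j ->
  mx_equiv A (\matrix_(x, y) (A x y + (if y == l then c * A x j else 0))).
Proof.
move=> lj; have jl : j != l by rewrite eq_sym.
have := mx_equiv_mulr A (@transvection_unit _ j l c jl).
congr mx_equiv; apply/matrixP=> x y; rewrite mulmxDr mulmx1 -scalemxAr !mxE.
congr (_ + _); rewrite (bigD1 j) //= !mxE eqxx big1 ?addr0; last first.
  by move=> k kj; rewrite !mxE (negPf kj) mulr0.
by case: eqP; rewrite ?mulr1 ?mulr0.
Qed.

(** The entry 1 clears its row and column by unipotent block factors; the Schur complement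
    [D - c *m r] remains. *)
Lemma mx_equiv_block1 m n (A : 'M[R]_(1 + m, 1 + n)) : A 0 0 = 1 ->
  exists B : 'M_(m, n), mx_equiv A (block_mx 1%:M 0 0 B).
Proof.
move=> A1; set r := ursubmx A; set c := dlsubmx A; set D := drsubmx A.
have AE : A = block_mx 1%:M r c D.
  rewrite -[LHS]submxK; congr block_mx; apply/matrixP=> i j.
  by rewrite !ord1 !mxE -A1 /=; congr (A _ _); apply: val_inj.
exists (D - c *m r); exists (block_mx 1%:M 0 (- c) 1%:M), (block_mx 1%:M (- r) 0 1%:M).
split; first by rewrite unitmxE det_lblock !det1 mulr1 unitr1.
  by rewrite unitmxE det_ublock !det1 mulr1 unitr1.
rewrite AE !mulmx_block !(mul1mx, mulmx1, mul0mx, mulmx0, addr0, add0r, mulmxN, mulNmx).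
rewrite !addNr mul0mx oppr0 add0r.
by rewrite addrC.
Qed.

Lemma mx_equiv_move00 m n (i : 'I_m.+1) (j : 'I_n.+1) (A : 'M[R]_(m.+1, n.+1)) :
  exists2 B, mx_equiv A B & B 0 0 = A i j.
Proof.
exists (xcol j 0 (xrow i 0 A)); last by rewrite !mxE !tpermR.
rewrite xrowE xcolE; apply: mx_equiv_trans (mx_equiv_mulr _ _).
  by apply: mx_equiv_mull; rewrite unitmx_perm.
by rewrite unitmx_perm.
Qed.

End Equivalence.

Section Smith.
Variable F : fieldType.
Local Notation PF := {poly F}.

(* A nonzero entry of smallest size among all matrices equivalent to [A]
   divides every other entry: otherwise a division yields a smaller one. *)
Lemma smith_pivot m n (A : 'M[PF]_(m.+1, n.+1)) i j : A i j != 0 ->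
  exists (a : PF) (B : 'M[PF]_(m, n)),
    a != 0 /\ mx_equiv A (a *: (block_mx 1%:M 0 0 B : 'M_(1 + m, 1 + n))).
Proof.
have [s] := ubnP (size (A i j)); elim: s => // s IHs in A i j * => leAs nzA.
(* [C] may differ from [A]: the last case modifies the row of the pivot before reducing it, while
   the induction on size needs only the pivot unchanged. *)
have redrow (C : 'M[PF]_(m.+1, n.+1)) l : mx_equiv A C -> C i j = A i j ->
  ~~ (C i j %| C i l) -> exists (a : PF) (B : 'M[PF]_(m, n)),
    a != 0 /\ mx_equiv A (a *: (block_mx 1%:M 0 0 B : 'M_(1 + m, 1 + n))).
  move=> AC CA ndv; have lj : l != j.
    by apply: contraNneq ndv => ->; rewrite dvdpp.
  have CD := @mx_equiv_addcol _ _ _ j l (- (C i l %/ C i j)) C lj.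
  set D := \matrix_(x, y) _ in CD.
  have De : D i l = C i l %% C i j.
    by rewrite mxE eqxx {1}(divp_eq (C i l) (C i j)) mulNr addrAC subrr add0r.
  have nzD : D i l != 0 by rewrite De.
  have [|a [B [nza DB]]] := IHs D i l _ nzD.
    by rewrite De -ltnS (leq_trans _ leAs) // ltnS -CA ltn_modp CA.
  by exists a, B; split=> //; apply: (mx_equiv_trans _ DB); apply: mx_equiv_trans CD.
have [/existsP [l ndv]|/existsPn rowdv] := boolP [exists l, ~~ (A i j %| A i l)].
  by apply: (redrow A l _ _ ndv); first exact: mx_equiv_refl.
have {}rowdv l : A i j %| A i l by have := rowdv l; rewrite negbK.
have [/existsP [k ndv]|/existsPn coldv] := boolP [exists k, ~~ (A i j %| A k j)].
  have ki : k != i by apply: contraNneq ndv => ->; rewrite dvdpp.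
  have AD := @mx_equiv_addrow _ _ _ k i (- (A k j %/ A i j)) A ki.
  set D := \matrix_(x, y) _ in AD.
  have De : D k j = A k j %% A i j.
    by rewrite mxE eqxx {1}(divp_eq (A k j) (A i j)) mulNr addrAC subrr add0r.
  have nzD : D k j != 0 by rewrite De.
  have [|a [B [nza DB]]] := IHs D k j _ nzD.
    by rewrite De -ltnS (leq_trans _ leAs) // ltnS ltn_modp.
  by exists a, B; split=> //; apply: (mx_equiv_trans _ DB).
have {}coldv k : A i j %| A k j by have := coldv k; rewrite negbK.
have [/existsP [k /existsP [l ndv]]|/existsPn alldv] :=
    boolP [exists k, [exists l, ~~ (A i j %| A k l)]].
  have ki : k != i by apply: contraNneq ndv => ->; rewrite rowdv.
  have ik : i != k by rewrite eq_sym.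
  (* Clear the entry (k, j), then add row k to row i: the pivot is unchanged and
     no longer divides its row. *)
  have AC := @mx_equiv_addrow _ _ _ k i (- (A k j %/ A i j)) A ki.
  set C := \matrix_(x, y) _ in AC.
  have CD := @mx_equiv_addrow _ _ _ i k 1 C ik.
  set D := \matrix_(x, y) _ in CD.
  have Dij : D i j = A i j.
    rewrite !mxE !eqxx (negPf ik) mul1r addr0 mulNr divpK ?coldv //.
    by rewrite subrr addr0.
  apply: (redrow D l) => //; first exact: mx_equiv_trans CD.
  rewrite Dij !mxE !eqxx (negPf ik) mul1r addr0 dvdp_addr ?rowdv //.
  by rewrite mulNr dvdp_addl // dvdpNr dvdp_mull ?rowdv.
have {}alldv k l : A i j %| A k l.
  by have /existsPn/(_ l) := alldv k; rewrite negbK.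
(* The pivot now divides every entry. Dividing it out leaves a 1, which is moved to the corner and
   used for elimination; the factor is restored afterwards. *)
have [B AB B1] := @mx_equiv_move00 _ _ _ i j (map_mx (fun q => q %/ A i j) A).
have [|D BD] := mx_equiv_block1 (A := B); first by rewrite B1 mxE divpp.
exists (A i j), D; split=> //.
have AE : A i j *: map_mx (fun q => q %/ A i j) A = A.
  by apply/matrixP=> x y; rewrite !mxE mulrC divpK ?alldv.
by rewrite -[X in mx_equiv X]AE; apply: mx_equivZ; apply: mx_equiv_trans BD.
Qed.

(** Induction on [m]. The pivot is a common factor of the remaining block, so it divides all later
    diagonal entries and preserves their divisibility chain. *)
Lemma smith_form m n (A : 'M[PF]_(m, n)) :
  exists e : seq PF,
    [/\ (size e <= m)%N, (size e <= n)%N, all (fun q => q \is monic) e,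
        (forall i, (i.+1 < size e)%N -> e`_i %| e`_i.+1) &
        mx_equiv A (diag_seq m n e)].
Proof.
elim: m => [|m IHm] in n A *.
  exists [::]; split=> //; rewrite [diag_seq _ _ _]flatmx0 [A]flatmx0.
  exact: mx_equiv_refl.
case: n A => [|n] A.
  exists [::]; split=> //; rewrite [diag_seq _ _ _]thinmx0 [A]thinmx0.
  exact: mx_equiv_refl.
have [/eqP ->|nzA] := boolP (A == 0).
  exists [::]; split=> //; have -> : diag_seq m.+1 n.+1 [::] = 0 :> 'M[PF]_(_, _).
    by apply/matrixP=> i j; rewrite !mxE nth_nil; case: eqP.
  exact: mx_equiv_refl.
have /existsP [i /existsP [j nzij]] : [exists i, [exists j, A i j != 0]].
  apply: contraNT nzA; move=> /existsPn A0; apply/eqP/matrixP=> i j; rewrite mxE.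
  by have /existsPn/(_ j) := A0 i; rewrite negbK => /eqP.
have [a [B [nza AB]]] := smith_pivot nzij.
have [e [sm sn mone dve [U [V [uU uV UBV]]]]] := IHm n B.
(* The pivot becomes monic by moving [c^-1], a unit of the polynomial ring, into the left
   transformation. *)
pose c := lead_coef a; have nzc : c != 0 by rewrite lead_coef_eq0.
pose b := c^-1 *: a; have monb : b \is monic.
  by rewrite monicE lead_coefZ mulVf.
exists (b :: map ( *%R b) e); split.
- by rewrite /= size_map.
- by rewrite /= size_map.
- rewrite /= monb all_map /=; apply/allP=> q qe /=.
  by rewrite monicMl // (allP mone).
- case=> [|k] /=; rewrite size_map ltnS => lt.
    by rewrite (nth_map 0) ?dvdp_mulr.
  have lt' := ltnW lt.
  by rewrite !(nth_map 0) // dvdp_mul2l ?monic_neq0 // dve.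
apply: (mx_equiv_trans AB).
have -> : diag_seq m.+1 n.+1 (b :: map ( *%R b) e) =
    b *: (block_mx 1%:M 0 0 (diag_seq m n e) : 'M[PF]_(1 + m, 1 + n)).
  apply/matrixP=> x y; rewrite !mxE.
  case: (splitP (x : 'I_(1 + m))) => x' xe; rewrite !mxE;
    case: (splitP (y : 'I_(1 + n))) => y' ye; rewrite !mxE xe ye ?ord1 ?add1n //= ?mulr1 ?mulr0 //.
  rewrite eqSS; case: ifP => _; last by rewrite mulr0.
  have [lt|ge] := ltnP x' (size e); first by rewrite (nth_map 0).
  by rewrite !nth_default ?size_map // mulr0.
have uc : c^-1%:P \is a GRing.unit.
  by rewrite poly_unitE size_polyC invr_eq0 nzc coefC eqxx unitfE invr_eq0 nzc.
have uU' : (block_mx (c^-1%:P)%:M 0 0 (c^-1%:P *: U) : 'M_(1 + m)) \in unitmx.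
  rewrite unitmxE det_ublock detZ det_scalar1 !unitrM uc -unitmxE uU andbT.
  exact: unitrX.
have uV' : (block_mx 1%:M 0 0 V : 'M_(1 + n)) \in unitmx.
  by rewrite unitmxE det_ublock det1 mul1r -unitmxE.
exists (block_mx (c^-1%:P)%:M 0 0 (c^-1%:P *: U) : 'M_(1 + m)).
exists (block_mx 1%:M 0 0 V : 'M_(1 + n)); split=> //.
have: (block_mx (c^-1%:P)%:M 0 0 (c^-1%:P *: U) : 'M_(1 + m)) *m
    (a *: block_mx 1%:M 0 0 B : 'M_(1 + m, 1 + n)) *m
    (block_mx 1%:M 0 0 V : 'M_(1 + n)) =
    b *: (block_mx 1%:M 0 0 (diag_seq m n e)).
  rewrite -scalemxAr -scalemxAl !mulmx_block.
  rewrite !(mul1mx, mulmx1, mul0mx, mulmx0, addr0, add0r) -!scalemxAl UBV.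
  rewrite !scale_block_mx !scaler0 -[1%:M in RHS]scalemx1 !scalerA /b -mul_polyC.
  by rewrite mulr1 -[(_%:P)%:M]scalemx1 scalerA [a * _]mulrC.
exact.
Qed.

End Smith.

(** * Rank and reversal *)

Section DiagonalRank.

(** The pattern of [diag_seq] with general entries, to describe the image of a Smith form over a
    field. *)
Definition rect_diag (R : nmodType) m n (e : seq R) : 'M[R]_(m, n) :=
  \matrix_(i < m, j < n) (if (i : nat) == j then e`_i else 0).

Lemma rank_rect_diag (K : fieldType) m n (e : seq K) :
  (size e <= m)%N -> (size e <= n)%N ->
  \rank (rect_diag m n e) = count (predC1 0) e.
Proof.
elim: e m n => [|a e IHe] [|m] [|n] //= sm sn.
- by rewrite [rect_diag _ _ _]flatmx0 mxrank0.
- by rewrite [rect_diag _ _ _]flatmx0 mxrank0.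
- by rewrite [rect_diag _ _ _]thinmx0 mxrank0.
- rewrite (_ : rect_diag _ _ _ = 0) ?mxrank0 //.
  by apply/matrixP=> i j; rewrite !mxE nth_nil; case: eqP.
have -> : rect_diag m.+1 n.+1 (a :: e) =
    (block_mx a%:M 0 0 (rect_diag m n e) : 'M_(1 + m, 1 + n)).
  apply/matrixP=> x y; rewrite !mxE.
  by case: (splitP (x : 'I_(1 + m))) => x' xe; rewrite !mxE;
    case: (splitP (y : 'I_(1 + n))) => y' ye; rewrite !mxE xe ye ?ord1 ?add1n.
rewrite (rank_diag_block_mx (a%:M : 'M_1)) IHe //; congr (_ + _)%N.
have [->|nz] /= := eqVneq a 0; first by rewrite raddf0 mxrank0.
by rewrite -scalemx1 mxrank_scale_nz ?mxrank1.
Qed.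

Variable F : fieldType.
Local Notation PF := {poly F}.

(** A ring morphism keeps [U] and [V] invertible, so the Smith form maps to a diagonal form over
    [K]. This covers both evaluation at a point and the embedding into fractions. *)
Lemma rank_map_equiv (K : fieldType) (f : {rmorphism PF -> K}) m n
    (A : 'M[PF]_(m, n)) e :
  (size e <= m)%N -> (size e <= n)%N -> mx_equiv A (diag_seq m n e) ->
  \rank (map_mx f A) = count (fun q => f q != 0) e.
Proof.
move=> sm sn [U [V [uU uV UAV]]].
have fU : map_mx f U \in unitmx by rewrite unitmxE det_map_mx rmorph_unit.
have fV : map_mx f V \in unitmx by rewrite unitmxE det_map_mx rmorph_unit.
have -> : \rank (map_mx f A) = \rank (map_mx f (U *m A *m V)).
  rewrite !map_mxM /= mxrankMfree ?row_free_unit //.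
  by rewrite eqmxMfull ?row_full_unit.
rewrite UAV (_ : map_mx f _ = rect_diag m n (map f e)); last first.
  apply/matrixP=> i j; rewrite !mxE; case: eqP => _; last by rewrite rmorph0.
  have [lt|ge] := ltnP i (size e); first by rewrite (nth_map 0).
  by rewrite !nth_default ?size_map ?rmorph0.
by rewrite rank_rect_diag ?size_map // count_map.
Qed.

Definition evalmx (x : F) m n (A : 'M[PF]_(m, n)) : 'M[F]_(m, n) :=
  map_mx (fun p : PF => p.[x]) A.

Lemma evalmxM x m n p (A : 'M[PF]_(m, n)) (B : 'M[PF]_(n, p)) :
  evalmx x (A *m B) = evalmx x A *m evalmx x B.
Proof. exact: (map_mxM (horner_eval x)). Qed.

Lemma rank_evalmx_equiv x m n (A : 'M[PF]_(m, n)) e :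
  (size e <= m)%N -> (size e <= n)%N -> mx_equiv A (diag_seq m n e) ->
  \rank (evalmx x A) = count (fun q => q.[x] != 0) e.
Proof. exact: (rank_map_equiv (horner_eval x)). Qed.

Lemma normal_rank_equiv m n (A : 'M[PF]_(m, n)) e :
  (size e <= m)%N -> (size e <= n)%N -> mx_equiv A (diag_seq m n e) ->
  normal_rank A = count (predC1 0) e.
Proof.
move=> sm sn eq; rewrite /normal_rank (rank_map_equiv (@tofrac _) sm sn eq).
by apply: eq_count => q; rewrite /= tofrac_eq0.
Qed.

Lemma smith_invariant_polys m n (A : 'M[PF]_(m, n)) :
  exists e, invariant_polys A e.
Proof.
have [e [sm sn mone dve eqA]] := smith_form A; exists e; split=> //.
rewrite (normal_rank_equiv sm sn eqA); apply/esym/eqP; rewrite -all_count.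
by apply/allP=> q /(allP mone); apply: monic_neq0.
Qed.

Lemma invariant_polys_size m n (A : 'M[PF]_(m, n)) e :
  invariant_polys A e -> (size e <= m)%N /\ (size e <= n)%N.
Proof. by case=> -> _ _ _; rewrite rank_leq_row rank_leq_col. Qed.

Lemma rank_evalmx x m n (A : 'M[PF]_(m, n)) e : invariant_polys A e ->
  \rank (evalmx x A) = count (fun q => q.[x] != 0) e.
Proof.
move=> inv; have [sm sn] := invariant_polys_size inv.
by case: inv => _ _ _ eqA; apply: rank_evalmx_equiv.
Qed.

(** Both ranks are read off one Smith form: evaluation counts only the invariant polynomials that do
    not vanish at [x]. *)
Lemma rank_evalmx_le x m n (A : 'M[PF]_(m, n)) :
  (\rank (evalmx x A) <= normal_rank A)%N.
Proof.
have [e inv] := smith_invariant_polys A; rewrite (rank_evalmx x inv).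
by case: inv => <- *; apply: count_size.
Qed.

Lemma mup0_horner (x : F) q : q != 0 -> (mup x q == 0%N) = (q.[x] != 0).
Proof. by move=> nzq; rewrite -[LHS]negbK -lt0n -XsubC_dvd // dvdp_XsubCl. Qed.

Lemma pmult_eq0_rank x m n (A : 'M[PF]_(m, n)) e : invariant_polys A e ->
  all (pred1 0%N) (pmult_seq x e) = (\rank (evalmx x A) == normal_rank A).
Proof.
move=> inv; rewrite (rank_evalmx x inv); case: inv => <- mone _ _.
rewrite -all_count all_map; apply: eq_in_all => q /(allP mone) mq /=.
by rewrite mup0_horner ?monic_neq0.
Qed.

(** Existence of a Smith form supplies the witness from right to left. All later arguments at
    infinity go through this rank condition. *)
Lemma pm_infty_zeroP d m n (A : 'M[PF]_(m, n)) :
  pm_infty_zero d A <->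
  \rank (evalmx 0 (revd d A)) = normal_rank (revd d A).
Proof.
split=> [[e [inv]]|/eqP rk]; first by rewrite (pmult_eq0_rank _ inv) => /eqP.
have [e inv] := smith_invariant_polys (revd d A).
by exists e; rewrite (pmult_eq0_rank _ inv).
Qed.

End DiagonalRank.

(** * Reversal of polynomials and of matrix products *)

Section Reversal.
Variable F : fieldType.
Local Notation PF := {poly F}.

(** The entrywise body of [revd]; coefficients of [p] beyond [d] are dropped. *)
Definition revp d (p : PF) : PF := \poly_(i < d.+1) p`_(d - i).

Lemma revpE d p : revp d p = \sum_(i < d.+1) p`_i *: 'X^(d - i).
Proof.
rewrite /revp poly_def (reindex_inj rev_ord_inj) /=.
by apply: eq_bigr => i _; rewrite subSS subKn // -ltnS.
Qed.

Lemma revpD d : {morph revp d : p q / p + q}.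
Proof.
move=> p q; apply/polyP=> i; rewrite coefD !coef_poly coefD.
by case: ifP => _; rewrite ?addr0.
Qed.

Lemma revp0 d : revp d 0 = 0.
Proof. by apply/polyP=> i; rewrite coef_poly !coef0; case: ifP. Qed.

Lemma revp_sum d I (r : seq I) (P : pred I) (f : I -> PF) :
  revp d (\sum_(i <- r | P i) f i) = \sum_(i <- r | P i) revp d (f i).
Proof. exact: (big_morph _ (revpD d) (revp0 d)). Qed.

Lemma revpZ d c p : revp d (c *: p) = c *: revp d p.
Proof.
apply/polyP=> i; rewrite coefZ !coef_poly coefZ.
by case: ifP => _; rewrite ?mulr0.
Qed.

Lemma revpXn d k : (k <= d)%N -> revp d 'X^k = 'X^(d - k).
Proof.
move=> kd; rewrite revpE (bigD1 (Ordinal (kd : k < d.+1)%N)) //= coefXn eqxx scale1r.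
rewrite big1 ?addr0 // => i; rewrite -val_eqE /= => ik.
by rewrite coefXn (negPf ik) scale0r.
Qed.

(** Bilinearity reduces this to monomials; the size bounds prevent truncation of either factor. *)
Lemma revpM a b (p q : PF) : (size p <= a.+1)%N -> (size q <= b.+1)%N ->
  revp (a + b) (p * q) = revp a p * revp b q.
Proof.
move=> sp sq; rewrite (revpE a) (revpE b) -{1}(coefK p) -{1}(coefK q).
have E (c : nat) (u : PF) : (size u <= c.+1)%N ->
    \poly_(i < size u) u`_i = \sum_(i < c.+1) u`_i *: 'X^i.
  move=> su; rewrite coefK -poly_def; apply/polyP=> i; rewrite coef_poly.
  by case: ltnP => // ge; rewrite nth_default // (leq_trans su).
rewrite (E _ _ sp) (E _ _ sq) !big_distrl revp_sum; apply: eq_bigr => i _ /=.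
rewrite !big_distrr revp_sum; apply: eq_bigr => j _ /=.
rewrite -!scalerAl -!scalerAr !scalerA revpZ -!exprD; congr (_ *: _).
have ia : (i <= a)%N by rewrite -ltnS.
have jb : (j <= b)%N by rewrite -ltnS.
rewrite revpXn ?leq_add //; congr ('X^_).
by rewrite -{1}(subnK ia) -{1}(subnK jb) addnACA addnK.
Qed.

Lemma horner_revp0 d p : (revp d p).[0] = p`_d.
Proof. by rewrite horner_coef0 coef_poly subn0. Qed.

(** The point 1 is fixed by inversion of the variable. There a matrix and its reversal can be
    compared, which later bounds the normal rank of the reversal from below. *)
Lemma horner_revp1 d (p : PF) : (size p <= d.+1)%N -> (revp d p).[1] = p.[1].
Proof.
move=> sp; rewrite revpE (horner_coef_wide _ sp) horner_sum.
by apply: eq_bigr => i _; rewrite hornerZ hornerXn !expr1n.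
Qed.

Lemma evalmx1_revd d m n (A : 'M[PF]_(m, n)) : polydeg_le d A ->
  evalmx 1 (revd d A) = evalmx 1 A.
Proof. by move=> dA; apply/matrixP=> i j; rewrite !mxE horner_revp1. Qed.

Section Product.
Variables (d m r n : nat) (a b : 'I_r -> nat).
Variables (L : 'M[PF]_(m, r)) (R : 'M[PF]_(r, n)).
Hypothesis sL : forall i k, (size (L i k) <= (a k).+1)%N.
Hypothesis sR : forall k j, (size (R k j) <= (b k).+1)%N.
Hypothesis dab : forall k, (a k + b k = d)%N.

(** Each summand [k] is reversed with its own splitting [d = a k + b k], so the degrees may vary
    with [k]. *)
Lemma revd_mul : revd d (L *m R) =
  (\matrix_(i, k) revp (a k) (L i k)) *m (\matrix_(k, j) revp (b k) (R k j)).
Proof.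
apply/matrixP=> i j; rewrite !mxE -/(revp d _) revp_sum; apply: eq_bigr => k _.
by rewrite !mxE -(dab k) revpM.
Qed.

Lemma normal_rank_revd_mul_le : (normal_rank (revd d (L *m R)) <= r)%N.
Proof.
rewrite revd_mul /normal_rank /fracmx map_mxM.
by rewrite (leq_trans (mxrankM_maxl _ _)) ?rank_leq_col.
Qed.

Lemma evalmx0_revd_mul : evalmx 0 (revd d (L *m R)) =
  (\matrix_(i, k) (L i k)`_(a k)) *m (\matrix_(k, j) (R k j)`_(b k)).
Proof.
rewrite revd_mul evalmxM; congr (_ *m _); apply/matrixP=> i j;
  by rewrite !mxE horner_revp0.
Qed.

End Product.

Lemma size_mulmx_le d m r n (a b : 'I_r -> nat)
    (L : 'M[PF]_(m, r)) (R : 'M[PF]_(r, n)) :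
  (forall i k, size (L i k) <= (a k).+1)%N ->
  (forall k j, size (R k j) <= (b k).+1)%N ->
  (forall k, a k + b k = d)%N -> polydeg_le d (L *m R).
Proof.
move=> sL sR dab i j; rewrite mxE (leq_trans (size_sum _ _ _)) //.
apply/bigmax_leqP=> k _; rewrite (leq_trans (size_polyMleq _ _)) //.
rewrite -(dab k) -ltnS.
have := leq_add (sL i k) (sR k j); rewrite addSn addnS.
by case: (_ + _)%N => //= s; rewrite ltnS.
Qed.

End Reversal.

(** * Minimal bases *)

Section MinimalBases.
Variable F : fieldType.
Local Notation PF := {poly F}.
Local Notation QF := {fraction {poly F}}.

Lemma fracmx_inj m n : injective (@fracmx F m n).
Proof.
move=> A B /matrixP AB; apply/matrixP=> i j; apply/eqP; rewrite -tofrac_eq.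
by have := AB i j; rewrite !mxE => ->.
Qed.

Lemma fracmxM m n p (A : 'M[PF]_(m, n)) (B : 'M[PF]_(n, p)) :
  fracmx (A *m B) = fracmx A *m fracmx B.
Proof. exact: map_mxM. Qed.

Lemma fracmx1 n : fracmx (1%:M : 'M[PF]_n) = 1%:M.
Proof. exact: map_mx1. Qed.

Lemma right_inverse_row_free p k (B : 'M[PF]_(p, k)) Y :
  B *m Y = 1%:M -> row_free (fracmx B).
Proof.
by move=> BY; apply/row_freeP; exists (fracmx Y); rewrite -fracmxM BY fracmx1.
Qed.

(** The coefficients [S] are a priori fractions; multiplying by [Y] identifies them with the
    polynomial matrix [A *m Y]. *)
Lemma submx_right_inverse m p k (A : 'M[PF]_(m, k)) (B : 'M[PF]_(p, k)) Y :
  B *m Y = 1%:M -> (fracmx A <= fracmx B)%MS -> A = A *m Y *m B.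
Proof.
move=> BY /submxP [S AE]; apply: fracmx_inj; rewrite !fracmxM AE.
by rewrite -(mulmxA S) -(fracmxM B) BY fracmx1 mulmx1.
Qed.

Lemma rvdeg_leP k (v : 'rV[PF]_k) N :
  reflect (forall j, (size (v ord0 j) <= N.+1)%N) (rvdeg v <= N)%N.
Proof.
have E (s : nat) : (s.-1 <= N)%N = (s <= N.+1)%N by case: s.
rewrite /rvdeg; apply: (iffP (bigmax_leqP _ _ _)) => le j; first by rewrite -E le.
by rewrite E.
Qed.

Lemma size_row_le p k (B : 'M[PF]_(p, k)) i j :
  (size (B i j) <= (rvdeg (row i B)).+1)%N.
Proof. by have /rvdeg_leP/(_ j) := leqnn (rvdeg (row i B)); rewrite mxE. Qed.

Lemma sumn_rowdegs p k (B : 'M[PF]_(p, k)) :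
  sumn (rowdegs B) = (\sum_i rvdeg (row i B))%N.
Proof. by rewrite sumnE big_map big_enum. Qed.

Lemma poly_basis_card q p p' k (V : 'M[QF]_(q, k)) (B : 'M[PF]_(p, k))
    (B' : 'M[PF]_(p', k)) : is_poly_basis V B -> is_poly_basis V B' -> p' = p.
Proof.
move=> /andP [/eqP fB eB] /andP [/eqP fB' eB'].
by rewrite -fB -fB' (eqmxP eB) (eqmxP eB').
Qed.

Lemma is_minimal_basis_eqmx q q' p k (V : 'M[QF]_(q, k)) (W : 'M[QF]_(q', k))
    (B : 'M[PF]_(p, k)) : (V == W)%MS ->
  is_minimal_basis V B -> is_minimal_basis W B.
Proof.
move=> VW; have E p' (B' : 'M[PF]_(p', k)) : is_poly_basis V B' = is_poly_basis W B'.
  congr (_ && _); apply/idP/idP => /eqmxP e; apply/eqmxP.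
    exact: eqmx_trans e (eqmxP VW).
  exact: eqmx_trans e (eqmx_sym (eqmxP VW)).
by move=> [bB mB]; split; [rewrite -E | move=> p' B'; rewrite -E; apply: mB].
Qed.

Lemma has_minimal_indices_eqmx q q' k (V : 'M[QF]_(q, k)) (W : 'M[QF]_(q', k)) idx :
  (V == W)%MS -> has_minimal_indices V idx -> has_minimal_indices W idx.
Proof. by move=> VW [B [mB pB]]; exists B; split=> //; apply: is_minimal_basis_eqmx mB. Qed.

(** Descent on the sum of degrees. All bases of [V] have the same number of rows, so it suffices to
    compare bases with [p] rows. *)
Lemma exists_minimal_basis q p k (V : 'M[QF]_(q, k)) (B0 : 'M[PF]_(p, k)) :
  is_poly_basis V B0 -> exists B : 'M[PF]_(p, k), is_minimal_basis V B.
Proof.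
have [N] := ubnP (sumn (rowdegs B0)); elim: N => // N IHN in B0 *.
rewrite ltnS => leN bB0.
have [[B [bB ltB]]|noB] := pselect (exists B : 'M[PF]_(p, k),
    is_poly_basis V B /\ (sumn (rowdegs B) < sumn (rowdegs B0))%N).
  exact: IHN (leq_trans ltB leN) bB.
exists B0; split=> // p' B' bB'; have E := poly_basis_card bB0 bB'; subst p'.
by rewrite leqNgt; apply/negP=> lt; apply: noB; exists B'.
Qed.

(* Replacing row [i0] of [B] by [w] gives another basis of the same space. *)
Lemma minimal_basis_exchange q p k (V : 'M[QF]_(q, k)) (B : 'M[PF]_(p, k))
    (w : 'rV[PF]_k) (c : 'rV[QF]_p) i0 :
  is_minimal_basis V B -> fracmx w = c *m fracmx B -> c 0 i0 != 0 ->
  exists j, (rvdeg (row i0 B) < size (w 0%R j))%N.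
Proof.
move=> [/andP [fB eB] mB] wE nzc; apply/existsP; apply: contraT => /existsPn small.
have {}small j : (size (w 0%R j) <= rvdeg (row i0 B))%N by rewrite leqNgt small.
pose B' : 'M[PF]_(p, k) := \matrix_i (if i == i0 then w else row i B).
have rB' i : row i B' = if i == i0 then w else row i B by rewrite rowK.
have rfB' i : row i (fracmx B') = if i == i0 then fracmx w else row i (fracmx B).
  by rewrite -map_row rB'; case: ifP => // _; rewrite map_row.
have B'B : (fracmx B' <= fracmx B)%MS.
  apply/row_subP=> i; rewrite rfB'; case: ifP => _; last exact: row_sub.
  by rewrite wE submxMl.
have BB' : (fracmx B <= fracmx B')%MS.
  have sub i : i != i0 -> (row i (fracmx B) <= fracmx B')%MS.
    by move=> ii0; have := row_sub i (fracmx B'); rewrite rfB' (negPf ii0).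
  apply/row_subP=> i; have [->|] := eqVneq i i0; last exact: sub.
  have E : fracmx w = c 0 i0 *: row i0 (fracmx B) +
      \sum_(i | i != i0) c 0 i *: row i (fracmx B).
    by rewrite wE mulmx_sum_row (bigD1 i0).
  (* The expansion of [w] is solved for row [i0], whose coefficient is invertible. *)
  have -> : row i0 (fracmx B) = (c 0 i0)^-1 *:
      (fracmx w - \sum_(i | i != i0) c 0 i *: row i (fracmx B)).
    by rewrite E addrK scalerA mulVf ?scale1r.
  rewrite scalemx_sub // addmx_sub //; first by have := row_sub i0 (fracmx B'); rewrite rfB' eqxx.
  by rewrite eqmx_opp summx_sub // => l li0; rewrite scalemx_sub // sub.
have eBB' : (fracmx B' :=: fracmx B)%MS by apply/eqmxP; rewrite B'B BB'.
have bB' : is_poly_basis V B'.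
  apply/andP; split; first by rewrite /row_free eBB'.
  by apply/eqmxP; apply: eqmx_trans eBB' (eqmxP eB).
have := mB _ _ bB'; rewrite !sumn_rowdegs (bigD1 i0) //= [X in (_ <= X)%N](bigD1 i0) //=.
have -> : rvdeg (row i0 B') = rvdeg w by congr rvdeg; rewrite rB' eqxx.
have -> : (\sum_(i | i != i0) rvdeg (row i B') = \sum_(i | i != i0) rvdeg (row i B))%N.
  by apply: eq_bigr => i /negPf ii0; congr rvdeg; rewrite rB' ii0.
rewrite leq_add2r.
(* Degree 0 is separate because [rvdeg] is also 0 on the zero vector: here [w] vanishes, against the
   freeness of [B]. In positive degree the sum of degrees drops strictly. *)
case N0 : (rvdeg (row i0 B)) => [|N].
  have w0 : w = 0.
    apply/matrixP=> i j; rewrite ord1 mxE; apply/eqP.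
    by rewrite -size_poly_leq0; have := small j; rewrite N0.
  have : c *m fracmx B == 0 by rewrite -wE w0 /fracmx map_mx0.
  by rewrite (mulmx_free_eq0 _ fB) => /eqP c0; rewrite c0 mxE eqxx in nzc.
move=> le; have: (rvdeg w <= N)%N by apply/rvdeg_leP=> j; have := small j; rewrite N0.
by rewrite leqNgt le.
Qed.

(** The highest row degree coefficient matrix: [B] is row reduced when this matrix has full row
    rank. *)
Definition hcoef p k (B : 'M[PF]_(p, k)) : 'M[F]_(p, k) :=
  \matrix_(i, j) (B i j)`_(rvdeg (row i B)).

Lemma coefM_top a b (p q : PF) : (size p <= a.+1)%N -> (size q <= b.+1)%N ->
  (p * q)`_(a + b) = p`_a * q`_b.
Proof. by move=> sp sq; rewrite -horner_revp0 revpM // hornerM !horner_revp0. Qed.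

Section TopCoefficients.
Variables (p k N : nat) (B : 'M[PF]_(p, k)) (t : 'rV[PF]_p).
(** Only rows occurring in the combination are bounded; the others may have degree above [N], where
    the subtraction truncates. *)
Hypothesis tN : forall i, t 0 i != 0 ->
  (rvdeg (row i B) <= N)%N /\ (size (t 0%R i) <= (N - rvdeg (row i B)).+1)%N.

Lemma size_mulmx_top j : (size ((t *m B)%R 0%R j) <= N.+1)%N.
Proof.
rewrite mxE (leq_trans (size_sum _ _ _)) //; apply/bigmax_leqP=> i _.
have [->|/tN [le st]] := eqVneq (t 0 i) 0; first by rewrite mul0r size_poly0.
rewrite (leq_trans (size_polyMleq _ _)) // -ltnS.
have := leq_add st (size_row_le B i j); rewrite addSn addnS subnK //.
by case: (_ + _)%N => //= s; rewrite ltnS.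
Qed.

Lemma coef_mulmx_top j : ((t *m B) 0 j)`_N =
  ((\row_i (t 0 i)`_(N - rvdeg (row i B))) *m hcoef B) 0 j.
Proof.
rewrite !mxE coef_sum; apply: eq_bigr => i _; rewrite !mxE.
have [->|/tN [le st]] := eqVneq (t 0 i) 0; first by rewrite mul0r !coef0 mul0r.
by rewrite -{1}(subnK le) coefM_top // size_row_le.
Qed.

End TopCoefficients.

(** At the largest value of [g], the coefficient of [t *m B] is a nontrivial combination of the
    independent rows of [hcoef B], so it cannot cancel. *)
Lemma predictable_degree p k (B : 'M[PF]_(p, k)) (t : 'rV[PF]_p) i :
  row_free (hcoef B) -> t 0 i != 0 ->
  ((size (t 0%R i)).-1 + rvdeg (row i B) <= rvdeg (t *m B)%R)%N.
Proof.
move=> fH nzi; pose g l := ((size (t 0%R l)).-1 + rvdeg (row l B))%N.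
rewrite -/(g i).
have [i0 nz0 max0] := @arg_maxnP _ i (fun l => t 0 l != 0) g nzi.
rewrite (leq_trans (max0 i nzi)) //.
have tN l : t 0 l != 0 ->
    (rvdeg (row l B) <= g i0)%N /\ (size (t 0%R l) <= (g i0 - rvdeg (row l B)).+1)%N.
  move=> nzl; have le : ((size (t 0%R l)).-1 + rvdeg (row l B) <= g i0)%N := max0 l nzl.
  have le2 : (rvdeg (row l B) <= g i0)%N by rewrite (leq_trans _ le) ?leq_addl.
  have s0 : (0 < size (t 0%R l))%N by rewrite lt0n size_poly_eq0.
  by split; rewrite // -(prednK s0) ltnS leq_subRL // addnC.
pose c := \row_l (t 0 l)`_(g i0 - rvdeg (row l B)).
have nzc : c != 0.
  apply/eqP=> /matrixP/(_ 0 i0); rewrite !mxE /g addnK => /eqP.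
  by rewrite -lead_coefE lead_coef_eq0 (negPf nz0).
have /existsP [j nzj] : [exists j, (c *m hcoef B) 0 j != 0].
  apply: contraNT nzc => /existsPn z; rewrite -(mulmx_free_eq0 _ fH).
  by apply/eqP/matrixP=> l j; rewrite ord1 [RHS]mxE; apply/eqP; have := z j; rewrite negbK.
rewrite leqNgt; apply/negP=> lt; case/negP: nzj.
rewrite -(coef_mulmx_top tN) nth_default //.
have := lt; case: (g i0) => // M; rewrite ltnS => /rvdeg_leP; exact.
Qed.

Lemma not_row_free_vec (K : fieldType) p k (M : 'M[K]_(p, k)) : ~~ row_free M ->
  exists2 c : 'rV[K]_p, c != 0 & c *m M = 0.
Proof.
rewrite -kermx_eq0 => /rowV0Pn [c /sub_kermxP cM nzc]; by exists c.
Qed.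

Lemma rV_nz_ex (K : nmodType) p (c : 'rV[K]_p) : c != 0 -> exists i, c 0 i != 0.
Proof.
move=> nzc; apply/existsP; apply: contraNT nzc => /existsPn z.
by apply/eqP/matrixP=> l j; rewrite ord1 [RHS]mxE; apply/eqP; have := z j; rewrite negbK.
Qed.

(** A relation [c] among the rows of [hcoef B] lifts to a combination whose coefficient at [N]
    cancels; exchanging it for a row of largest degree in the relation contradicts minimality. *)
Lemma minimal_basis_reduced q p k (V : 'M[QF]_(q, k)) (B : 'M[PF]_(p, k)) :
  is_minimal_basis V B -> row_free (hcoef B).
Proof.
move=> mB; apply: contraT => /not_row_free_vec [c /rV_nz_ex [i nzi] cH].
have [i0 nz0 max0] :=
  @arg_maxnP _ i (fun l => c 0 l != 0) (fun l => rvdeg (row l B)) nzi.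
set N := rvdeg (row i0 B) in max0.
(* The powers of ['X] raise all rows in the relation to the common degree [N]; the entry at [i0] is
   a nonzero constant. *)
pose t : 'rV[PF]_p := \row_l (c 0 l *: 'X^(N - rvdeg (row l B))).
have tN l : t 0 l != 0 ->
    (rvdeg (row l B) <= N)%N /\ (size (t 0%R l) <= (N - rvdeg (row l B)).+1)%N.
  rewrite mxE scaler_eq0 negb_or => /andP [nzl _]; split; first exact: max0.
  by rewrite size_scale // size_polyXn.
have [|j] := @minimal_basis_exchange _ _ _ _ _ (t *m B) (fracmx t) i0 mB (fracmxM _ _).
  by rewrite mxE tofrac_eq0 mxE subnn scaler_eq0 negb_or nz0 expr0 oner_eq0.
rewrite -/N => lt; have: ((t *m B) 0 j)`_N != 0.
  have := size_mulmx_top tN j; move: lt; rewrite leq_eqVlt => /orP [/eqP sE _|lt le].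
    have -> : N = (size ((t *m B) 0 j)).-1 by rewrite -sE.
    by rewrite -lead_coefE lead_coef_eq0 -size_poly_eq0 -sE.
  by have := leq_trans lt le; rewrite ltnn.
rewrite (coef_mulmx_top tN) (_ : \row_l _ = c) ?cH ?mxE ?eqxx //.
by apply/rowP=> l; rewrite !mxE coefZ coefXn eqxx mulr1.
Qed.

(** Any other basis is [T *m B] with [T] polynomial, thanks to [Y], and nonsingular. A nonzero
    Leibniz term of its determinant matches the rows of the two bases, and predictable degree
    compares each pair. *)
Lemma reduced_is_minimal_basis p k (B : 'M[PF]_(p, k)) Y :
  row_free (hcoef B) -> B *m Y = 1%:M -> is_minimal_basis (fracmx B) B.
Proof.
move=> fH BY; have bB : is_poly_basis (fracmx B) B.
  by rewrite /is_poly_basis (right_inverse_row_free BY) submx_refl.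
split=> // p' B' bB'; have E := poly_basis_card bB bB'; subst p'.
have /andP [fB' /andP [B'B _]] := bB'.
have B'E := submx_right_inverse BY B'B; set T := B' *m Y in B'E.
have nzT : \det T != 0.
  have: row_free (fracmx T).
    rewrite /row_free eqn_leq rank_leq_row /= -[X in (X <= _)%N](eqP fB') {1}B'E.
    by rewrite fracmxM mxrankM_maxl.
  by rewrite row_free_unit unitmxE det_map_mx unitfE tofrac_eq0.
have /existsP [s nzs] : [exists s : 'S_p, \prod_i T i (s i) != 0].
  apply: contraNT nzT => /existsPn z; apply/eqP/big1=> s _.
  by have := z s; rewrite negbK => /eqP ->; rewrite mulr0.
rewrite !sumn_rowdegs (reindex_inj (@perm_inj _ s)) /=; apply: leq_sum => i _.
have nz : row i T 0 (s i) != 0 by rewrite mxE; have /prodf_neq0/(_ i isT) := nzs.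
have := predictable_degree fH nz; rewrite -row_mul -B'E.
exact: leq_trans (leq_addl _ _).
Qed.

Lemma diag_seq1 m n r : diag_seq m n (nseq r 1) = pid_mx r :> 'M[PF]_(m, n).
Proof.
apply/matrixP=> i j; rewrite !mxE; case: eqP => //= _.
by rewrite nth_nseq; case: ltnP.
Qed.

(** The Smith form is [pid_mx p] with [p <= k], which has an explicit right inverse; it is
    conjugated back by [U] and [V]. *)
Lemma invariant_polys1_right_inverse p k (B : 'M[PF]_(p, k)) :
  invariant_polys B (nseq p 1) -> exists Y, B *m Y = 1%:M.
Proof.
move=> inv; have [_] := invariant_polys_size inv; rewrite size_nseq => pk.
case: inv => _ _ _ [U [V [uU uV]]]; rewrite diag_seq1 => UBV.
exists (V *m pid_mx p *m U); rewrite !mulmxA.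
have -> : B *m V = invmx U *m pid_mx p by rewrite -UBV -mulmxA mulKmx.
rewrite -(mulmxA (invmx U)) mul_pid_mx minnn (minn_idPr pk) pid_mx_1 mulmx1.
by rewrite mulVmx.
Qed.

End MinimalBases.

(** * Minimal bases over an algebraically closed field *)

Section ClosedField.
Variable F : closedFieldType.
Local Notation PF := {poly F}.

(** If [c] annihilates the value at [x], the combination of rows is divisible by ['X - x%:P]. The
    quotient has smaller degree than the largest row involved, so an exchange contradicts
    minimality. *)
Lemma minimal_basis_eval_row_free q p k (V : 'M_(q, k)) (B : 'M[PF]_(p, k)) x :
  is_minimal_basis V B -> row_free (evalmx x B).
Proof.
move=> mB; apply: contraT => /not_row_free_vec [c /rV_nz_ex [i nzi] cB].
have [i0 nz0 max0] :=
  @arg_maxnP _ i (fun l => c 0 l != 0) (fun l => rvdeg (row l B)) nzi.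
set N := rvdeg (row i0 B) in max0.
pose t : 'rV[PF]_p := map_mx polyC c.
have tN l : t 0 l != 0 ->
    (rvdeg (row l B) <= N)%N /\ (size (t 0%R l) <= (N - rvdeg (row l B)).+1)%N.
  rewrite mxE polyC_eq0 => nzl; split; first exact: max0.
  by rewrite size_polyC nzl.
pose w : 'rV[PF]_k := map_mx (fun u => u %/ ('X - x%:P)) (t *m B).
have nzX : 'X - x%:P != 0 :> PF by rewrite polyXsubC_eq0.
have rt j : ('X - x%:P) %| (t *m B) 0 j.
  rewrite dvdp_XsubCl; apply/rootP.
  have := congr1 (fun M : 'rV_k => M 0 j) (evalmxM x t B); rewrite mxE => ->.
  rewrite (_ : evalmx x t = c) ?cB ?mxE //.
  by apply/rowP=> l; rewrite !mxE hornerC.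
have wE : t *m B = ('X - x%:P) *: w.
  by apply/rowP=> j; rewrite [RHS]mxE [w 0 j]mxE mulrC divpK.
have [||j] := @minimal_basis_exchange _ _ _ _ _ _ w
  ((tofrac ('X - x%:P))^-1 *: fracmx t) i0 mB.
- rewrite -scalemxAl -fracmxM wE /fracmx map_mxZ scalerA mulVf ?scale1r //.
  by rewrite tofrac_eq0.
- by rewrite !mxE mulf_neq0 ?invr_eq0 ?tofrac_eq0 ?polyC_eq0.
rewrite -/N ltnNge => /negP[]; rewrite mxE size_divp // size_XsubC subn1.
by have := size_mulmx_top tN j; case: (size _).
Qed.

(** A nonconstant invariant polynomial would have a root, and the rank would drop there; a monic
    constant is 1. *)
Lemma invariant_polys1_eval m n r (A : 'M[PF]_(m, n)) :
  normal_rank A = r -> (forall x, \rank (evalmx x A) = r) ->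
  invariant_polys A (nseq r 1).
Proof.
move=> rk ev; have [e inv] := smith_invariant_polys A.
suff <- : e = nseq r 1 by [].
have {}ev x : count (fun q => q.[x] != 0) e = r by rewrite -(rank_evalmx x inv).
case: inv => se mone _ _; rewrite rk in se.
apply: (@eq_from_nth _ 0); first by rewrite size_nseq.
move=> i ie; rewrite nth_nseq -se ie.
have mi : e`_i \is monic by rewrite (allP mone) // mem_nth.
have: size e`_i == 1%N.
  apply: contraT => /closed_rootP [x /rootP ex0].
  have := ev x; rewrite -se => /eqP.
  by rewrite -all_count => /allP/(_ _ (mem_nth 0 ie)); rewrite ex0 eqxx.
move=> /size_poly1P [c nzc ec]; move: mi.
by rewrite ec monicE lead_coefC => /eqP ->.
Qed.

Lemma minimal_basis_right_inverse q p k (V : 'M_(q, k)) (B : 'M[PF]_(p, k)) :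
  is_minimal_basis V B -> exists Y, B *m Y = 1%:M.
Proof.
move=> mB; apply: invariant_polys1_right_inverse; apply: invariant_polys1_eval.
  by case: mB => [/andP [/eqP]].
by move=> x; apply/eqP; apply: minimal_basis_eval_row_free mB.
Qed.

End ClosedField.

(** * Factorization *)

Section FreeProducts.
Variable K : fieldType.

Lemma kermx_mul_free m r n (A : 'M[K]_(m, r)) (B : 'M_(r, n)) :
  row_free B -> (kermx (A *m B) == kermx A)%MS.
Proof.
move=> fB; apply/andP; split; apply/sub_kermxP.
  by apply/eqP; rewrite -(mulmx_free_eq0 _ fB) -mulmxA mulmx_ker.
by rewrite mulmxA mulmx_ker mul0mx.
Qed.

Lemma mxrank_mul_free m r n (A : 'M[K]_(m, r)) (B : 'M_(r, n)) :
  row_free A^T -> row_free B -> \rank (A *m B) = r.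
Proof. by move=> /eqP fA fB; rewrite mxrankMfree // -mxrank_tr. Qed.

Lemma row_free_nz_entry p k (A : 'M[K]_(p, k)) i :
  row_free A -> exists j, A i j != 0.
Proof.
move=> fA; have: row i A != 0.
  rewrite rowE (mulmx_free_eq0 _ fA); apply/eqP=> /matrixP/(_ 0 i).
  by rewrite !mxE !eqxx; apply/eqP/oner_neq0.
by move=> /rV_nz_ex [j]; rewrite mxE; exists j.
Qed.

End FreeProducts.

Section Factorization.
Variables (F : closedFieldType) (m n r d : nat).
Local Notation PF := {poly F}.

Lemma left_null_mul (L : 'M[PF]_(m, r)) (R : 'M[PF]_(r, n)) :
  row_free (fracmx R) -> (left_null (L *m R) == left_null L)%MS.
Proof. by move=> fR; rewrite /left_null fracmxM kermx_mul_free. Qed.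

Lemma right_null_mul (L : 'M[PF]_(m, r)) (R : 'M[PF]_(r, n)) :
  row_free (fracmx L^T) -> (right_null (L *m R) == right_null R)%MS.
Proof.
move=> fL; rewrite /right_null fracmxM trmx_mul kermx_mul_free //.
by rewrite /fracmx map_trmx.
Qed.

Lemma minimal_factors_product (L : 'M[PF]_(m, r)) (R : 'M[PF]_(r, n)) :
  is_minimal_basis (fracmx L^T) L^T -> is_minimal_basis (fracmx R) R ->
  (forall k, rvdeg (row k L^T) + rvdeg (row k R) = d)%N ->
  [/\ polydeg_le d (L *m R), normal_rank (L *m R) = r,
      invariant_polys (L *m R) (nseq r 1) & pm_infty_zero d (L *m R)].
Proof.
move=> mL mR dLR.
have sL i k : (size (L i k) <= (rvdeg (row k L^T)).+1)%N.
  by have := size_row_le L^T k i; rewrite mxE.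
have sR := size_row_le R.
have rk : normal_rank (L *m R) = r.
  rewrite /normal_rank fracmxM mxrank_mul_free //; last by case: mR => [/andP []].
  by rewrite /fracmx map_trmx; case: mL => [/andP []].
have rk0 : \rank (evalmx 0 (revd d (L *m R))) = r.
  rewrite (evalmx0_revd_mul sL sR dLR) mxrank_mul_free //.
    have := minimal_basis_reduced mL; congr row_free.
    by apply/matrixP=> k i; rewrite !mxE.
  exact: minimal_basis_reduced mR.
split=> //; first exact: size_mulmx_le sL sR dLR.
  apply: invariant_polys1_eval => // x; rewrite evalmxM mxrank_mul_free //.
    by rewrite /evalmx map_trmx; apply: minimal_basis_eval_row_free mL.
  exact: minimal_basis_eval_row_free mR.
(* The normal rank of the reversal is squeezed between its rank [r] at 0 and the inner dimension
   [r]. *)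
apply/pm_infty_zeroP; apply/eqP; rewrite eqn_leq rank_evalmx_le rk0 /=.
exact: normal_rank_revd_mul_le sL sR dLR.
Qed.

Lemma minimal_factorization (P : 'M[PF]_(m, n)) :
  invariant_polys P (nseq r 1) ->
  exists (L : 'M[PF]_(m, r)) (R : 'M[PF]_(r, n)) X,
    [/\ X *m L = 1%:M, is_minimal_basis (fracmx R) R & P = L *m R].
Proof.
move=> inv; have [] := invariant_polys_size inv; rewrite size_nseq => rm rn.
case: inv => _ _ _ [U [V [uU uV]]]; rewrite diag_seq1 => UPV.
pose L0 : 'M[PF]_(m, r) := invmx U *m pid_mx r.
pose R0 : 'M[PF]_(r, n) := pid_mx r *m invmx V.
pose X0 : 'M[PF]_(r, m) := pid_mx r *m U; pose Y0 : 'M[PF]_(n, r) := V *m pid_mx r.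
have XL0 : X0 *m L0 = 1%:M.
  by rewrite /X0 /L0 mulmxA mulmxK // mul_pid_mx minnn (minn_idPr rm) pid_mx_1.
have RY0 : R0 *m Y0 = 1%:M.
  by rewrite /R0 /Y0 mulmxA mulmxKV // mul_pid_mx minnn (minn_idPr rn) pid_mx_1.
have PE : P = L0 *m R0.
  rewrite /L0 /R0 mulmxA -(mulmxA (invmx U)) mul_pid_mx !minnn -UPV.
  by rewrite -!mulmxA mulKmx // mulmxV // mulmx1.
have bR0 : is_poly_basis (fracmx R0) R0.
  by rewrite /is_poly_basis (right_inverse_row_free RY0) submx_refl.
have [R mR0] := exists_minimal_basis bR0.
have [/andP [_ eRR0] _] := mR0.
have mR : is_minimal_basis (fracmx R) R.
  by apply: is_minimal_basis_eqmx mR0; rewrite andbC.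
have [Y RY] := minimal_basis_right_inverse mR.
have [R_R0 R0_R] := andP eRR0.
have RE := submx_right_inverse RY0 R_R0; have R0E := submx_right_inverse RY R0_R.
(* [R0 *m Y] and [R *m Y0] are the two polynomial changes of basis between [R0] and [R]; the first
   is absorbed into the left factor, the second into its left inverse. *)
exists (L0 *m (R0 *m Y)), R, (R *m Y0 *m X0); split=> //.
  by rewrite mulmxA -(mulmxA (R *m Y0)) XL0 mulmx1 mulmxA -RE.
by rewrite -mulmxA -R0E.
Qed.

Lemma minimal_bases_factorization (P : 'M[PF]_(m, n)) :
  polydeg_le d P -> invariant_polys P (nseq r 1) -> pm_infty_zero d P ->
  exists (L : 'M[PF]_(m, r)) (R : 'M[PF]_(r, n)),
    [/\ is_minimal_basis (fracmx L^T) L^T, is_minimal_basis (fracmx R) R,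
        (forall k, rvdeg (row k L^T) + rvdeg (row k R) = d)%N & P = L *m R].
Proof.
move=> dP inv /pm_infty_zeroP inf.
have [L [R [X [XL mR PE]]]] := minimal_factorization inv.
have XLT : L^T *m X^T = 1%:M by rewrite -trmx_mul XL trmx1.
pose rho k := rvdeg (row k R).
have dL i k : L i k != 0 -> ((size (L i k)).-1 + rho k <= d)%N.
  move=> nz; have nz' : row i L 0 k != 0 by rewrite mxE.
  have := predictable_degree (minimal_basis_reduced mR) nz'.
  rewrite mxE -row_mul -PE => /leq_trans; apply.
  by apply/rvdeg_leP=> j; rewrite mxE.
(* Every column of [L] has a nonzero entry, so the subtraction defining [a k] is exact. *)
have rho_le k : (rho k <= d)%N.
  have [l] := row_free_nz_entry k (right_inverse_row_free XLT).
  rewrite !mxE tofrac_eq0 => /dL; apply: leq_trans; exact: leq_addl.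
pose a k := (d - rho k)%N.
have da k : (a k + rho k = d)%N by rewrite /a subnK.
have sL i k : (size (L i k) <= (a k).+1)%N.
  have [->|nz] := eqVneq (L i k) 0; first by rewrite size_poly0.
  have s0 : (0 < size (L i k))%N by rewrite lt0n size_poly_eq0.
  by rewrite -(prednK s0) ltnS leq_subRL // addnC dL.
have sR := size_row_le R.
pose Lc : 'M[F]_(m, r) := \matrix_(i, k) (L i k)`_(a k).
(* The chain is: [r] is the rank of [P] at 1, hence of its reversal at 1, which is at most the
   normal rank of the reversal. By the condition at infinity this equals the rank at 0, at most that
   of [Lc]. *)
have fLc : row_free Lc^T.
  rewrite /row_free mxrank_tr eqn_leq rank_leq_col /=.
  have rk1 : \rank (evalmx 1 P) = r.
    by rewrite (rank_evalmx 1 inv) count_nseq hornerE oner_eq0 mul1n.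
  rewrite -[X in (X <= _)%N]rk1 -(evalmx1_revd dP).
  rewrite (leq_trans (rank_evalmx_le _ _)) // -inf PE.
  by rewrite (evalmx0_revd_mul sL sR da) mxrankM_maxl.
have degL k : rvdeg (row k L^T) = a k.
  apply/eqP; rewrite eqn_leq; apply/andP; split.
    by apply/rvdeg_leP=> i; rewrite !mxE.
  have [i nz] := row_free_nz_entry k fLc; rewrite leqNgt; apply/negP=> lt.
  case/eqP: nz; rewrite !mxE nth_default //.
  by have := size_row_le L^T k i; rewrite mxE => /leq_trans; apply.
exists L, R; split=> //; last by move=> k; rewrite degL da.
(* With the exact degrees known, [Lc^T] is [hcoef L^T], so [L^T] is row reduced. *)
apply: reduced_is_minimal_basis XLT; have := fLc; congr row_free.
by apply/matrixP=> k i; rewrite !mxE degL.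
Qed.

End Factorization.

(* C = Rl[i] for an arbitrary realType Rl (i.e. the complex numbers) *)
Theorem theorem4p16 (Rl : realType) (m n r d a : nat) :
  (2 <= m)%N -> (2 <= n)%N -> (1 <= d)%N -> (0 < r)%N -> (r < minn m n)%N ->
  (a <= r * d)%N ->
  let alpha := (a %/ (n - r))%N in
  let s := (a %% (n - r))%N in
  let beta := ((r * d - a) %/ (m - r))%N in
  let t := ((r * d - a) %% (m - r))%N in
  let lidx := nseq t beta.+1 ++ nseq (m - r - t) beta in
  let ridx := nseq s alpha.+1 ++ nseq (n - r - s) alpha in
  forall P : 'M[{poly Rl[i]}]_(m, n),
    O_a r d lidx ridx P <->
    exists (L : 'M[{poly Rl[i]}]_(m, r)) (R : 'M[{poly Rl[i]}]_(r, n)),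
      [/\ is_minimal_basis (fracmx L^T) L^T,
          is_minimal_basis (fracmx R) R,
          has_minimal_indices (left_null L) lidx,
          has_minimal_indices (right_null R) ridx &
          (forall k : 'I_r, rvdeg (row k L^T) + rvdeg (row k R) = d)%N /\
          P = L *m R].
Proof.
move=> _ _ _ _ _ _ alpha s beta t lidx ridx P; split.
  move=> [dP _ inv inf [lP rP]].
  have [L [R [mL mR dLR PE]]] := minimal_bases_factorization dP inv inf.
  have fL : row_free (fracmx L^T) by case: mL => [/andP []].
  have fR : row_free (fracmx R) by case: mR => [/andP []].
  exists L, R; split; [exact: mL | exact: mR | | | by split].
    (* Each nullspace of the product is that of one factor, because the other factor has full rank
       and cancels. *)
    by apply: (has_minimal_indices_eqmx _ lP); rewrite PE; apply: left_null_mul.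
  by apply: (has_minimal_indices_eqmx _ rP); rewrite PE; apply: right_null_mul.
move=> [L [R [mL mR lL rR [dLR ->]]]].
have fL : row_free (fracmx L^T) by case: mL => [/andP []].
have fR : row_free (fracmx R) by case: mR => [/andP []].
have [dP rk inv inf] := minimal_factors_product mL mR dLR.
split; [exact: dP | exact: rk | exact: inv | exact: inf | split].
  by apply: (has_minimal_indices_eqmx _ lL); rewrite andbC; apply: left_null_mul.
by apply: (has_minimal_indices_eqmx _ rR); rewrite andbC; apply: right_null_mul.
Qed.
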